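(* Let $F,G\in\mathbb{Z}[x]\setminus\{0\}$, and let $C,U,V$ be their support factors. If $UV$ fails to have a root modulo infinitely many primes (i.e. there are infinitely many primes modulo which $UV$ has no root), then $\mathcal{P}(F,G)$ does not hold. Consequently, $$\mathcal{P}(F,G)\quad\Longrightarrow\quad UV\text{ has a root modulo all but finitely many primes}.$$
   Context: $\mathbb{N}=\{1,2,\ldots\}$. For $A\subset\mathbb{N}$ and $m\in\mathbb{Z}$, put $d_A(m)=\#\{a\in A: a\mid m\}$, which may be infinite (in particular $d_A(0)=|A|$). For $u,v\in\mathbb{Z}$ define $\delta_A(u,v)=0$ if $u=v=0$; $\delta_A(u,v)=\infty$ if exactly one of $u,v$ is zero; $\delta_A(u,v)=|d_A(u)-d_A(v)|$ if $uv\neq 0$. For $F,G\in\mathbb{Z}[x]$, $\mathcal{P}(F,G)$ denotes the property: for every infinite $A\subset\mathbb{N}$, $\limsup_{n\to\infty}\delta_A(F(n),G(n))=\infty$ ($n$ running over positive integers). Support factors: write a nonzero $P\in\mathbb{Z}[x]$ as $P=c_P\prod_{\phi\in\mathcal{I}_P}\phi^{e_P(\phi)}$ with $c_P\in\mathbb{Z}\setminus\{0\}$, $e_P(\phi)\ge 1$, and $\mathcal{I}_P$ a finite set of pairwise nonassociate (nonconstant) primitive irreducible polynomials in $\mathbb{Z}[x]$ with positive leading coefficients. For nonzero $F,G$, set $C=\prod_{\phi\in\mathcal{I}_F\cap\mathcal{I}_G}\phi$, $U=\prod_{\phi\in\mathcal{I}_F\setminus\mathcal{I}_G}\phi$, $V=\prod_{\phi\in\mathcal{I}_G\setminus\mathcal{I}_F}\phi$,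 an empty product being $1$. *)

(* Defs.v *)
From HB Require Import structures.
From mathcomp Require Import all_boot all_order all_algebra finmap.
From mathcomp Require Import all_classical all_reals all_analysis.

Set Implicit Arguments.
Unset Strict Implicit.
Unset Printing Implicit Defensive.

Import Order.TTheory GRing.Theory Num.Theory.

Local Open Scope classical_set_scope.
Local Open Scope ring_scope.

Definition divisor_count (R : realType) (A : set nat) (m : int) : \bar R :=
  counting [set a | A a /\ (a%:Z %| m)%Z].

Definition delta (R : realType) (A : set nat) (u v : int) : \bar R :=
  if (u == 0) && (v == 0) then 0%E
  else if (u == 0) || (v == 0) then +oo%E
  else `|divisor_count R A u - divisor_count R A v|%E.

(* The index is shifted because n runs over the positive integers. *)
Definition property_P (R : realType) (F G : {poly int}) : Prop :=
  forall A : set nat, A `<=` [set a | (0 < a)%N] -> infinite_set A ->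
    limn_esup (fun n : nat => delta R A F.[n.+1%:Z] G.[n.+1%:Z]) = +oo%E.

(* Irreducibility in the ring Z[x]; MathComp's irreducible_poly, which rests on
   pseudo-division, is irreducibility over the fraction field. *)
Definition irreducibleZ (phi : {poly int}) : Prop :=
  [/\ phi != 0, phi \isn't a GRing.unit &
      forall q r : {poly int}, phi = q * r ->
        q \is a GRing.unit \/ r \is a GRing.unit].

Definition associateZ (phi psi : {poly int}) : Prop :=
  exists2 u : {poly int}, u \is a GRing.unit & psi = u * phi.

(* zcontents is signed, hence the absolute value. *)
Definition support_poly (phi : {poly int}) : Prop :=
  [/\ (1 < size phi)%N, `|zcontents phi|%N = 1%N, irreducibleZ phi &
      0 < lead_coef phi].

Definition is_support (P : {poly int}) (I : {fset {poly int}}) : Prop :=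
  [/\ forall phi, phi \in I -> support_poly phi,
      forall phi psi, phi \in I -> psi \in I -> phi != psi ->
        ~ associateZ phi psi &
      exists (c : int) (e : {poly int} -> nat),
        [/\ c != 0, forall phi, phi \in I -> (1 <= e phi)%N &
            P = c%:P * \prod_(phi <- I) phi ^+ e phi]].

Definition support_factors (F G C U V : {poly int}) : Prop :=
  exists IF IG : {fset {poly int}},
    [/\ is_support F IF, is_support G IG,
        C = \prod_(phi <- (IF `&` IG)%fset) phi,
        U = \prod_(phi <- (IF `\` IG)%fset) phi &
        V = \prod_(phi <- (IG `\` IF)%fset) phi].

Definition has_root_mod (P : {poly int}) (p : nat) : Prop :=
  exists x : int, (p%:Z %| P.[x])%Z.

Lemma is_support_exists (P : {poly int}) : P != 0 -> exists I, is_support P I.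
Proof.
move=> P0.
have [c [s [c0 hs ->]]] : exists (c : int) (s : seq {poly int}),
    [/\ c != 0, forall phi, phi \in s -> support_poly phi &
        P = c%:P * \prod_(phi <- s) phi].
  have [n] := ubnP (size P); elim: n P P0 => // n IHn P P0; rewrite ltnS => hn.
  have c0 : zcontents P != 0 by rewrite zcontents_eq0.
  have [s1|s1] := leqP (size P) 1.
    have [c Dc] : {c | P = c%:P} by exists P`_0; apply: size1_polyC.
    exists c, [::]; split=> //; last by rewrite big_nil mulr1.
    by rewrite -polyC_eq0 -Dc.
  set Q := zprimitive P.
  have Q1 : zcontents Q = 1 by rewrite zcontents_primitive P0.
  have Q0 : Q != 0 by rewrite zprimitive_eq0.
  have sQ : size Q = size P by rewrite size_zprimitive.
  have lQ : 0 < lead_coef Q by rewrite -sgz_gt0 -sgz_contents Q1.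
  have nuQ : Q \isn't a GRing.unit.
    by rewrite poly_unitE sQ (gtn_eqF s1).
  have DP : P = (zcontents P)%:P * Q by rewrite mul_polyC -zpolyEprim.
  have [iQ|] := pselect (irreducibleZ Q).
    exists (zcontents P), [:: Q]; split=> //; last by rewrite big_seq1.
    move=> phi; rewrite inE => /eqP ->; split=> //; first by rewrite sQ.
    by rewrite Q1.
  move=> niQ.
  have [q [r [DQ nq nr]]] : exists q r : {poly int},
      [/\ Q = q * r, q \isn't a GRing.unit & r \isn't a GRing.unit].
    apply: contrapT => H; apply: niQ; split=> // q r DQ.
    have [?|nq] := boolP (q \is a GRing.unit); first by left.
    have [?|nr] := boolP (r \is a GRing.unit); first by right.
    by case: H; exists q, r.
  have unit1 (f g : {poly int}) : Q = f * g -> (size f <= 1)%N ->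
      f \is a GRing.unit.
    move=> DQ' /size1_polyC Df; move: DQ'; rewrite Df mul_polyC => DQ'.
    have := Q1; rewrite DQ' zcontentsZ => h.
    rewrite poly_unitE coefC eqxx.
    have u : f`_0 \is a GRing.unit.
      by apply/unitrP; exists (zcontents g); rewrite mulrC h.
    rewrite u andbT size_polyC.
    have -> // : f`_0 != 0 by apply: contraTneq u => ->; rewrite unitr0.
  have [q0 r0] : q != 0 /\ r != 0.
    by apply/andP; move: Q0; rewrite DQ mulf_eq0 negb_or.
  have gq : (1 < size q)%N by rewrite ltnNge; apply: contra nq; apply: unit1 DQ.
  have gr : (1 < size r)%N.
    by rewrite ltnNge; apply: contra nr; apply: (@unit1 _ q); rewrite mulrC.
  have sE : size P = (size q + size r).-1 by rewrite -sQ DQ size_mul.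
  have [|a [s [a0 hs Dq]]] := IHn q q0.
    apply: leq_trans hn; rewrite sE; case: (size r) gr => [|[|k]] // _.
    by rewrite !addnS /= ltnS leq_addr.
  have [|b [t [b0 ht Dr]]] := IHn r r0.
    apply: leq_trans hn; rewrite sE; case: (size q) gq => [|[|k]] // _.
    by rewrite !addSn /= ltnS leq_addl.
  exists (zcontents P * a * b), (s ++ t); split.
  - exact: mulf_neq0 (mulf_neq0 c0 a0) b0.
  - by move=> phi; rewrite mem_cat => /orP[/hs|/ht].
  - rewrite {1}DP DQ Dq Dr big_cat /=; move: (zcontents P) => d.
    by rewrite !polyCM -!mulrA; do 2!congr (_ * _); rewrite mulrCA.
exists [fset phi in s]%fset; split.
- by move=> phi; rewrite inE; exact: hs.
- move=> phi psi; rewrite !inE => /hs[_ c1 _ l1] /hs[_ c2 _ l2] neq [u uu Du].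
  have z1 (f : {poly int}) : `|zcontents f|%N = 1%N -> 0 < lead_coef f ->
      zcontents f = 1.
    rewrite -sgz_gt0 -sgz_contents => h1 h2.
    by rewrite [LHS]intEsg h1 mulr1; move: h2; case: sgzP.
  move: uu; rewrite poly_unitE => /andP[/eqP su _].
  have /size1_polyC Eu : (size u <= 1)%N by rewrite su.
  have := z1 _ c2 l2; rewrite Du Eu mul_polyC zcontentsZ (z1 _ c1 l1) mulr1 => e.
  by move: neq; rewrite Du Eu e mul1r eqxx.
- exists c, (fun phi => count_mem phi s); split=> //.
    by move=> phi; rewrite inE -has_count has_pred1.
  congr (_ * _); rewrite -(prodr_undup_exp_count s xpredT id).
  apply: perm_big; apply: uniq_perm; rewrite ?undup_uniq ?fset_uniq //.
  by move=> x; rewrite mem_undup inE.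
Qed.

(* Main.v *)
Require Import Defs.
From mathcomp Require Import all_boot all_order all_algebra finmap.
From mathcomp Require Import all_classical all_reals all_analysis.

Import Order.TTheory GRing.Theory Num.Theory.

Local Open Scope classical_set_scope.
Local Open Scope ring_scope.

(** The set A that defeats P(F, G) consists of the primes p modulo which U * V
    has no root, with the finitely many divisors of the constants c_F
    and c_G removed.  For such a p and any integer x, p divides F(x) exactly
    when p divides phi(x) for some irreducible factor phi of F
    ([prime_dvd_support]).  That phi cannot be a factor of U, since x would be
    a root of U * V modulo p; hence phi is a common factor of F and G, and p
    divides G(x).  The situation is symmetric in F and G, so F(x) and G(x) have
    exactly the same divisors in A.

    This gives delta_A(F(x), G(x)) = 0 for every x ([delta_eq0]).  The zeros of
    F and G need no separate treatment: if F(x) = 0 then all the primes of the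
    infinite set A divide G(x), so that G(x) = 0 as well, while if both values
    are nonzero the two divisor counts are finite and equal.  The upper limit is
    therefore 0. *)

Lemma Euclid_dvdz_prod (I : Type) (s : seq I) (f : I -> int) (p : nat) :
  prime p ->
  (p%:Z %| \prod_(i <- s) f i)%Z = has (fun i => (p%:Z %| f i)%Z) s.
Proof.
move=> pp; elim: s => [|i s IHs] /=.
  by rewrite big_nil dvdzE dvdn1; case: p pp => [|[|]].
by rewrite big_cons -IHs !dvdzE abszM Euclid_dvdM.
Qed.

Lemma finite_divisors (m : int) :
  m != 0 -> finite_set [set a : nat | (a%:Z %| m)%Z].
Proof.
move=> m0; apply: (sub_finite_set _ (finite_II `|m|%N.+1)) => a /=.
by rewrite dvdzE ltnS => /dvdn_leq; apply; rewrite absz_gt0.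
Qed.

(** The exponents are positive, so they do not affect divisibility by a prime;
    the constant c is the only obstruction to reading off from the support
    which primes divide a value of P. *)
Lemma prime_dvd_support (P : {poly int}) (I : {fset {poly int}}) :
  is_support P I ->
  exists2 c : int, c != 0 &
    forall (p : nat) (x : int), prime p -> ~~ (p%:Z %| c)%Z ->
      (p%:Z %| P.[x])%Z = has (fun phi => (p%:Z %| phi.[x])%Z) I.
Proof.
move=> [_ _ [c [e [c0 e1 ->]]]]; exists c => // p x pp pc.
rewrite hornerM hornerC horner_prod dvdzE abszM Euclid_dvdM // -!dvdzE.
rewrite (negbTE pc) /= Euclid_dvdz_prod //.
apply: eq_in_has => phi /e1 ephi.
by rewrite horner_exp !dvdzE abszX Euclid_dvdX // ephi andbT.
Qed.

(** If p divides phi(x), then phi belongs to J: otherwise it would be a factor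
    of the product over I \ J, whose value at x is prime to p. *)
Lemma dvd_support_transfer (I J : {fset {poly int}}) (p : nat)
    (x : int) :
  prime p -> ~~ (p%:Z %| (\prod_(phi <- (I `\` J)%fset) phi).[x])%Z ->
  has (fun phi => (p%:Z %| phi.[x])%Z) I ->
  has (fun phi => (p%:Z %| phi.[x])%Z) J.
Proof.
move=> pp; rewrite horner_prod Euclid_dvdz_prod // => /hasPn nU.
move=> /hasP[phi phiI pphi]; apply/hasP; exists phi => //.
apply/negPn/negP => phiJ; have := nU phi.
by rewrite inE phiI phiJ pphi => /(_ isT).
Qed.

(** When u = 0, every element of A divides v, which forces v = 0 because A is
    infinite; so the mixed case, where delta is infinite, does not arise. *)
Lemma delta_eq0 (R : realType) (A : set nat) (u v : int) :
  infinite_set A ->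
  (forall a : nat, A a -> (a%:Z %| u)%Z = (a%:Z %| v)%Z) ->
  delta R A u v = 0%E.
Proof.
move=> infA uv.
have zero (w z : int) : (forall a : nat, A a -> (a%:Z %| w)%Z = (a%:Z %| z)%Z) ->
    w = 0 -> z == 0.
  move=> wz w0; apply: contraT => /finite_divisors finz.
  by case: infA; apply: sub_finite_set finz => a Aa /=; rewrite -wz // w0 dvdz0.
rewrite /delta; have [u0|u0] /= := eqVneq u 0; first by rewrite (zero u v).
have [v0|v0] /= := eqVneq v 0.
  by case/eqP: u0; apply/eqP; apply: (zero v) => // a Aa; rewrite uv.
have -> : divisor_count R A v = divisor_count R A u.
  congr counting; apply/seteqP.
  by split=> a [Aa av]; split=> //; rewrite ?uv // -uv.
have fin : finite_set [set a | A a /\ (a%:Z %| u)%Z].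
  by apply: sub_finite_set (finite_divisors _ u0) => a [].
by rewrite /divisor_count /counting asboolT // subee // abse0.
Qed.

Theorem theorem1p3 (R : realType) (F G C U V : {poly int})
    (hF : F != 0) (hG : G != 0) (hCUV : support_factors F G C U V) :
  (infinite_set [set p : nat | prime p /\ ~ has_root_mod (U * V) p] ->
     ~ property_P R F G) /\
  (property_P R F G ->
     finite_set [set p : nat | prime p /\ ~ has_root_mod (U * V) p]).
Proof.
have main : infinite_set [set p : nat | prime p /\ ~ has_root_mod (U * V) p] ->
    ~ property_P R F G.
  case: hCUV => [IF [IG [sF sG _ DU DV]]] infS.
  have [cF cF0 dvdF] := prime_dvd_support _ _ sF.
  have [cG cG0 dvdG] := prime_dvd_support _ _ sG.
  pose A := [set p : nat | prime p /\ ~ has_root_mod (U * V) p]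
              `\` [set p : nat | (p%:Z %| cF * cG)%Z].
  have infA : infinite_set A.
    by apply: infinite_setD => //; apply: finite_divisors; rewrite mulf_neq0.
  have sameA (x : int) (p : nat) : A p -> (p%:Z %| F.[x])%Z = (p%:Z %| G.[x])%Z.
    move=> [[pp noroot] /negP pc].
    have pcF : ~~ (p%:Z %| cF)%Z by apply: contra pc; apply: dvdz_mulr.
    have pcG : ~~ (p%:Z %| cG)%Z by apply: contra pc; apply: dvdz_mull.
    have pU : ~~ (p%:Z %| U.[x])%Z.
      by apply/negP => h; apply: noroot; exists x; rewrite hornerM dvdz_mulr.
    have pV : ~~ (p%:Z %| V.[x])%Z.
      by apply/negP => h; apply: noroot; exists x; rewrite hornerM dvdz_mull.
    rewrite dvdF // dvdG //; apply/idP/idP.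
      by apply: dvd_support_transfer => //; rewrite -DU.
    by apply: dvd_support_transfer => //; rewrite -DV.
  have posA : A `<=` [set a | (0 < a)%N] by move=> p [[/prime_gt0]].
  move=> /(_ A posA infA).
  have -> : (fun n => delta R A F.[n.+1%:Z] G.[n.+1%:Z]) = cst 0%E.
    by apply/funext => n; apply: delta_eq0 => // p; apply: sameA.
  rewrite is_cvg_limn_esupE; last exact: is_cvg_cst.
  by rewrite lim_cst.
by split=> // PFG; apply: contrapT => /main.
Qed.
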